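(* For every complete multipartite graph $H$ there is an integer $k_0$ such that for every $k\ge k_0$, $H$ is $k$-Tur\'an-good.
   Context: For graphs $H,G$, $\mathcal{N}(H,G)$ denotes the number of subgraphs of $G$ isomorphic to $H$. $\mathrm{ex}(n,H,F)$ is the maximum of $\mathcal{N}(H,G)$ over all $n$-vertex graphs $G$ not containing $F$ as a subgraph. The Tur\'an graph $T_{r}(n)$ is the complete $r$-partite graph on $n$ vertices whose classes each have size $\lfloor n/r\rfloor$ or $\lceil n/r\rceil$. A graph $H$ not containing $K_k$ is $k$-Tur\'an-good if $\mathrm{ex}(n,H,K_k)=\mathcal{N}(H,T_{k-1}(n))$ for every sufficiently large $n$. *)

(* Defs.v *)
From mathcomp Require Import all_boot.
Set Implicit Arguments.
Unset Strict Implicit.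
Unset Printing Implicit Defensive.

(* A finite simple graph on T, given by its set of two-element edges. *)
Definition sgraph (T : finType) : predArgType :=
  {E : {set {set T}} | [forall e in E, #|e| == 2]}.

Definition edges (T : finType) (G : sgraph T) : {set {set T}} := sval G.

Definition adj (T : finType) (G : sgraph T) : rel T :=
  [rel x y | [set x; y] \in edges G].

Definition rel_edges (T : finType) (r : rel T) : {set {set T}} :=
  [set e | [exists x, exists y, [&& x != y, r x y & e == [set x; y]]]].

Lemma rel_edgesP (T : finType) (r : rel T) :
  [forall e in rel_edges r, #|e| == 2].
Proof.
apply/forall_inP => e; rewrite inE.
by case/existsP => x /existsP [y /and3P [xy _ /eqP ->]]; rewrite cards2 xy.
Qed.

(* Loops of r are dropped and r is symmetrized. *)
Definition graph_of_rel (T : finType) (r : rel T) : sgraph T :=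
  exist _ (rel_edges r) (rel_edgesP r).

Lemma adj_graph_of_rel (T : finType) (r : rel T) x y :
  adj (graph_of_rel r) x y = (x != y) && (r x y || r y x).
Proof.
rewrite /adj /= /edges /= inE; apply/existsP/andP => [[u /existsP [v]]|[xy]].
  case/and3P => uv ruv /eqP E.
  have xy : x != y by have := cards2 x y; rewrite E cards2 uv; case: (x != y).
  split=> //.
  have /set2P xuv : x \in [set u; v] by rewrite -E set21.
  have /set2P yuv : y \in [set u; v] by rewrite -E set22.
  by case: xuv yuv xy => -> [] ->; rewrite ?eqxx ?ruv ?orbT.
case/orP => rxy.
  by exists x; apply/existsP; exists y; rewrite xy rxy eqxx.
by exists y; apply/existsP; exists x; rewrite eq_sym xy rxy setUC eqxx.
Qed.

Definition complete_graph (k : nat) : sgraph 'I_k :=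
  graph_of_rel [rel x y | x != y].

(* The class of x is its residue mod r; see [card_turan_class]. *)
Definition turan_graph (r n : nat) : sgraph 'I_n :=
  graph_of_rel [rel x y : 'I_n | x %% r != y %% r].

Lemma card_turan_class (r n i : nat) : i < r ->
  #|[set x : 'I_n | x %% r == i]| = n %/ r + (i < n %% r).
Proof.
move=> ir; rewrite -sum1_card.
under eq_bigl do rewrite inE.
rewrite -(big_mkord (fun x => x %% r == i) (fun _ => 1)).
have r0 : 0 < r by apply: leq_ltn_trans ir.
elim: n => [|n IH]; first by rewrite big_geq // div0n mod0n.
rewrite big_mkcond big_nat_recr //= -big_mkcond IH divnS // modnS.
have mr := ltn_pmod n r0.
have -> : (r %| n.+1) = ((n %% r).+1 == r).
  rewrite /dvdn -addn1 -modnDml addn1.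
  case: (eqVneq (n %% r).+1 r) => [->|ne]; first by rewrite modnn.
  by rewrite modn_small // ltn_neqAle ne.
move: mr; set m := n %% r => mr.
case: (eqVneq m.+1 r) => [E|_] /=.
  by move: ir; rewrite -{1}E ltnS !addn0 -addnA addnC; case: ltngtP.
by rewrite ltnS add0n -addnA; case: ltngtP.
Qed.

(* A pair (W, D) stands for the graph with vertex set W and edge set D. *)
Definition is_subgraph (T : finType) (G : sgraph T)
    (S : {set T} * {set {set T}}) : bool :=
  (S.2 \subset edges G) && [forall e in S.2, e \subset S.1].

Definition is_iso (U T : finType) (H : sgraph U)
    (S : {set T} * {set {set T}}) : bool :=
  [exists f : {ffun U -> T},
    [&& injectiveb f, [set f x | x : U] == S.1
      & [forall x, forall y, adj H x y == ([set f x; f y] \in S.2)]]].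

Definition copies (U T : finType) (H : sgraph U) (G : sgraph T) :
    {set {set T} * {set {set T}}} :=
  [set S | is_subgraph G S && is_iso H S].

Definition Ncopies (U T : finType) (H : sgraph U) (G : sgraph T) : nat :=
  #|copies H G|.

Definition contains (U T : finType) (F : sgraph U) (G : sgraph T) : bool :=
  copies F G != set0.

Definition ex_copies (n : nat) (U W : finType) (H : sgraph U) (F : sgraph W) : nat :=
  \max_(G : sgraph 'I_n | ~~ contains F G) Ncopies H G.

Definition complete_multipartite (U : finType) (H : sgraph U) : Prop :=
  exists2 P : {set {set U}}, partition P [set: U] &
    forall x y, adj H x y = (pblock P x != pblock P y).

Definition turan_good (k : nat) (U : finType) (H : sgraph U) : Prop :=
  ~~ contains (complete_graph k) H /\
  exists n0, forall n, n0 <= n ->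
    ex_copies n H (complete_graph k) = Ncopies H (turan_graph k.-1 n).

(* Main.v *)
Require Import Defs.
From mathcomp Require Import all_boot.
From mathcomp Require Import perm zify.

Set Implicit Arguments.
Unset Strict Implicit.
Unset Printing Implicit Defensive.

(* Write H for the pattern, h for its number of vertices, and n for the number
   of vertices of the host graph.  Counting copies of H amounts to counting
   embeddings, since each copy comes from |Aut H| of them.

   Zykov symmetrization: if u and v are nonadjacent in the host, replacing u by
   a clone of v loses the embeddings using u but not v and gains as many as use
   v but not u.  Embeddings using both survive because u and v then sit in one
   class of H.  Hence some maximiser among K_k-free graphs is complete
   multipartite, i.e. given by a colouring c with k - 1 colours.

   Large colour classes are excluded by comparison with the Turan graph: a class
   of size z kills a proportion (z/n)^2 of all maps, while the Turan graph only
   loses a proportion O(h^2/k).  When all classes are small compared to n, moving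
   a vertex w from a class to a smaller class does not lower the count: swapping
   the smaller class with an equally large part of the bigger one matches gains
   and losses, up to embeddings that meet the surplus Z of the bigger class.  The
   remaining losses also need a vertex in the smaller class, so there are only
   O(|Z| m n^(h-3)) of them, m being the largest class size, whereas the remaining
   gains number about |Z| n^(h-2). *)

(** * Embeddings, and their relation to copies *)

Definition embeddings (V T : finType) (h : rel V) (e : rel T) :
    {set {ffun V -> T}} :=
  [set f : {ffun V -> T} |
    injectiveb f && [forall x, forall y, h x y ==> e (f x) (f y)]].

Lemma embeddingsP (V T : finType) (h : rel V) (e : rel T) (f : {ffun V -> T}) :
  reflect (injective f /\ forall x y, h x y -> e (f x) (f y))
          (f \in embeddings h e).
Proof.
rewrite inE; apply: (iffP andP) => -[/injectiveP fI fh]; split=> //.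
  by move=> x y; move/forallP: fh => /(_ x) /forallP /(_ y) /implyP.
by apply/forallP => x; apply/forallP => y; apply/implyP; apply: fh.
Qed.

Lemma eq_embeddings (V T : finType) (h : rel V) (e e' : rel T) :
  e =2 e' -> embeddings h e = embeddings h e'.
Proof.
move=> ee; apply/setP => f; rewrite !inE; congr (_ && _).
by apply: eq_forallb => x; apply: eq_forallb => y; rewrite ee.
Qed.

Lemma adj_sym (T : finType) (G : sgraph T) : symmetric (adj G).
Proof. by move=> x y; rewrite /adj /= setUC. Qed.

Lemma adj_irr (T : finType) (G : sgraph T) : irreflexive (adj G).
Proof.
move=> x; apply/negP; rewrite /adj /= /edges => xx.
by have /forall_inP/(_ _ xx) := svalP G; rewrite setUid cards1.
Qed.

Lemma edge_ends (T : finType) (G : sgraph T) e :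
  e \in edges G -> exists x y, e = [set x; y].
Proof.
move=> eG; have /forall_inP/(_ _ eG) := svalP G.
by case/cards2P => x [y [_ ->]]; exists x, y.
Qed.

Definition automorphisms (V : finType) (h : rel V) : {set {ffun V -> V}} :=
  [set g : {ffun V -> V} |
    injectiveb g && [forall x, forall y, h x y == h (g x) (g y)]].

Lemma automorphisms_gt0 (V : finType) (h : rel V) : 0 < #|automorphisms h|.
Proof.
apply/card_gt0P; exists [ffun x => x]; rewrite inE; apply/andP; split.
  by apply/injectiveP => x y; rewrite !ffunE.
by apply/forallP => x; apply/forallP => y; rewrite !ffunE.
Qed.

Definition image_copy (V T : finType) (H : sgraph V) (f : {ffun V -> T}) :
    {set T} * {set {set T}} :=
  ([set f x | x : V], [set f @: (e : {set V}) | e in edges H]).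

Lemma set2_inj (V T : finType) (f : V -> T) (x y a b : V) : injective f ->
  [set f x; f y] = [set f a; f b] -> [set x; y] = [set a; b].
Proof.
move=> fI E; apply: (imset_inj fI).
by rewrite !imsetU !imset_set1.
Qed.

Lemma mem_image_copy (V T : finType) (H : sgraph V) (f : {ffun V -> T}) x y :
  injective f -> ([set f x; f y] \in (image_copy H f).2) = adj H x y.
Proof.
move=> fI; apply/imsetP/idP => [[e eH]|xy].
  have [a [b eE]] := edge_ends eH; rewrite eE imsetU !imset_set1 in eH *.
  by move/(set2_inj fI) => E; rewrite /adj /= E.
by exists [set x; y] => //; rewrite imsetU !imset_set1.
Qed.

Lemma image_copy_copies (V T : finType) (H : sgraph V) (G : sgraph T) f :
  f \in embeddings (adj H) (adj G) -> image_copy H f \in copies H G.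
Proof.
case/embeddingsP => fI fh; rewrite inE; apply/andP; split; last first.
  apply/existsP; exists f; apply/and3P; split=> //; first exact/injectiveP.
  by apply/forallP => x; apply/forallP => y; rewrite mem_image_copy.
apply/andP; split.
  apply/subsetP => _ /imsetP [e eH ->].
  have [a [b eE]] := edge_ends eH; rewrite eE imsetU !imset_set1 in eH *.
  exact: fh.
apply/forall_inP => _ /imsetP [e _ ->].
by apply/subsetP => _ /imsetP [x _ ->]; apply: imset_f.
Qed.

Lemma iso_image_copy (V T : finType) (H : sgraph V) (G : sgraph T) S :
  S \in copies H G ->
  exists2 f, f \in embeddings (adj H) (adj G) & image_copy H f = S.
Proof.
rewrite inE => /andP [/andP [SG /forall_inP SW]] /existsP [f].
case/and3P => /injectiveP fI /eqP fW /forallP fh; exists f.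
  apply/embeddingsP; split=> // x y xy; apply: (subsetP SG).
  by have /forallP/(_ y)/eqP <- := fh x.
rewrite [S]surjective_pairing /image_copy fW; congr (_, _).
apply/setP => e; apply/imsetP/idP => [[d dH ->]|eS].
  have [a [b dE]] := edge_ends dH; rewrite dE imsetU !imset_set1 in dH *.
  by have /forallP/(_ b)/eqP <- := fh a.
have [x [y eE]] := edge_ends (subsetP SG _ eS).
have := SW _ eS; rewrite eE subUset !sub1set -fW => /andP [].
case/imsetP => a _ xE /imsetP [b _ yE].
exists [set a; b]; last by rewrite imsetU !imset_set1 xE yE.
by have /forallP/(_ b)/eqP := fh a; rewrite -xE -yE -eE eS.
Qed.

(* The embeddings onto a given copy form one orbit of the automorphism group,
   acting freely. *)
Lemma Ncopies_embeddings (V T : finType) (H : sgraph V) (G : sgraph T) :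
  Ncopies H G * #|automorphisms (adj H)| = #|embeddings (adj H) (adj G)|.
Proof.
rewrite -[RHS]sum1_card (partition_big (image_copy H) (mem (copies H G))) /=;
  last by move=> f; apply: image_copy_copies.
rewrite /Ncopies -sum_nat_const; apply: eq_bigr => S SC.
have [f0 f0E f0S] := iso_image_copy SC; have [f0I f0h] := embeddingsP _ _ _ f0E.
rewrite sum1dep_card.
pose act (g : {ffun V -> V}) := [ffun x => f0 (g x)].
have actI : injective act.
  move=> g1 g2 E; apply/ffunP => x; apply: f0I.
  by have /ffunP/(_ x) := E; rewrite !ffunE.
rewrite -(card_imset _ actI); apply: eq_card => f; rewrite [RHS]inE.
apply/imsetP/andP => [[g]|[fE /eqP fS]].
  rewrite inE => /andP [/injectiveP gI /forallP gh] ->.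
  have aI : injective (act g) by move=> x y; rewrite !ffunE => /f0I /gI.
  have gadj x y : adj H (g x) (g y) = adj H x y.
    by have /forallP/(_ y)/eqP <- := gh x.
  split.
    apply/embeddingsP; split=> // x y xy.
    by rewrite !ffunE; apply: f0h; rewrite gadj.
  have gS x : exists y, x = g y.
    by have [g' _ gK] := injF_bij gI; exists (g' x); rewrite gK.
  rewrite -f0S; apply/eqP; congr (_, _).
    apply/setP => t; apply/imsetP/imsetP => -[x _ ->].
      by exists (g x); rewrite // ffunE.
    by have [y ->] := gS x; exists y; rewrite // ffunE.
  apply/setP => t; apply/imsetP/imsetP => -[e eH ->].
    have [a [b eE]] := edge_ends eH; rewrite {}eE in eH *.
    exists [set g a; g b]; first by move: eH; rewrite -[_ \in _]/(adj H a b) -gadj.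
    by rewrite !imsetU !imset_set1 !ffunE.
  have [a [b eE]] := edge_ends eH; rewrite {}eE in eH *.
  have [a' aE] := gS a; have [b' bE] := gS b.
  exists [set a'; b']; last by rewrite !imsetU !imset_set1 !ffunE aE bE.
  by move: eH; rewrite -[_ \in _]/(adj H a b) aE bE gadj.
(* Conversely, [f] and [f0] have the same image, so [g], the inverse of [f0] after [f], is defined;
   it is an automorphism because adjacency can be read off from the common copy. *)
have [fI fh] := embeddingsP _ _ _ fE.
have im x : exists y, f x == f0 y.
  have : f x \in (image_copy H f).1 by apply: imset_f.
  by rewrite fS -f0S => /imsetP [y _ ->]; exists y.
pose g := [ffun x => xchoose (im x)].
have gE x : f0 (g x) = f x by rewrite ffunE; apply/esym/eqP/(xchooseP (im x)).
exists g; last by apply/ffunP => x; rewrite ffunE gE.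
rewrite inE; apply/andP; split.
  by apply/injectiveP => x y E; apply: fI; rewrite -!gE E.
apply/forallP => x; apply/forallP => y.
by rewrite -(mem_image_copy H x y fI) fS -f0S -!gE mem_image_copy.
Qed.

Lemma leq_Ncopies (V T T' : finType) (H : sgraph V)
    (G : sgraph T) (G' : sgraph T') :
  (Ncopies H G <= Ncopies H G') =
  (#|embeddings (adj H) (adj G)| <= #|embeddings (adj H) (adj G')|).
Proof.
by rewrite -!Ncopies_embeddings leq_pmul2r // automorphisms_gt0.
Qed.

Lemma containsE (V T : finType) (H : sgraph V) (G : sgraph T) :
  contains H G = (embeddings (adj H) (adj G) != set0).
Proof.
by rewrite /contains -!card_gt0 -Ncopies_embeddings muln_gt0 automorphisms_gt0 andbT.
Qed.

(** Injectivity comes for free: distinct indices have adjacent images, and adjacency is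
    irreflexive. *)
Lemma contains_completeP (T : finType) (G : sgraph T) (k : nat) :
  reflect (exists f : 'I_k -> T, forall i j, i != j -> adj G (f i) (f j))
          (contains (complete_graph k) G).
Proof.
rewrite containsE; apply: (iffP (set0Pn _)) => -[f].
  case/embeddingsP => _ fh; exists f => i j ij; apply: fh.
  by rewrite adj_graph_of_rel /= ij.
move=> fh; exists [ffun x => f x]; apply/embeddingsP; split.
  move=> i j; rewrite !ffunE => E; apply/eqP/negP => /negP /fh.
  by rewrite E adj_irr.
by move=> i j; rewrite adj_graph_of_rel !ffunE => /andP [ij _]; apply: fh.
Qed.

(** * Zykov symmetrization *)

(** The pullback of [e] along the map that sends [u] to [v] and fixes everything else, so that [u]
    becomes a clone of [v]. *)
Definition clone_rel (T : finType) (e : rel T) (u v : T) : rel T :=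
  [rel x y | e (if x == u then v else x) (if y == u then v else y)].

Lemma clone_rel_sym (T : finType) (e : rel T) u v :
  symmetric e -> symmetric (clone_rel e u v).
Proof. by move=> eC x y; rewrite /clone_rel /= eC. Qed.

Lemma clone_rel_irr (T : finType) (e : rel T) u v :
  irreflexive e -> irreflexive (clone_rel e u v).
Proof. by move=> e0 x; rewrite /clone_rel /= e0. Qed.

Definition embeddings_only (V T : finType) (h : rel V) (e : rel T) (u v : T) :
    {set {ffun V -> T}} :=
  [set f in embeddings h e | (u \in codom f) && (v \notin codom f)].

(* Embeddings through both [u] and [v] survive because [u] and [v] must then
   occupy vertices of [V] with the same neighbourhood. *)
Lemma embeddings_clone (V T : finType) (h : rel V) (e : rel T) (u v : T) :
    symmetric h -> (forall x y, ~~ h x y -> h x =1 h y) ->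
    symmetric e -> irreflexive e -> ~~ e u v ->
  #|embeddings h e| + #|embeddings_only h e v u| <=
  #|embeddings h (clone_rel e u v)| + #|embeddings_only h e u v|.
Proof.
move=> hC htw eC e0 euv.
(* The embeddings in [K] survive unchanged, while [tau] moves those through [v] only onto the clone
   [u]. A moved map uses [u] but not [v], so it lies outside [K] and the two families add up. *)
pose K := embeddings h e :\: embeddings_only h e u v.
pose tau (f : {ffun V -> T}) := [ffun p => tperm u v (f p)].
have tauI : injective tau.
  move=> f g E; apply/ffunP => x; apply: (@perm_inj _ (tperm u v)).
  by have /ffunP/(_ x) := E; rewrite !ffunE.
have -> : #|embeddings h e| = #|embeddings_only h e u v| + #|K|.
  rewrite -(cardsID (embeddings_only h e u v)) (setIidPr _) //.
  by apply/subsetP => f /setIdP [].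
rewrite addnC addnA addnAC -(card_imset _ tauI) leq_add2r.
have dis : [disjoint tau @: embeddings_only h e v u & K].
  rewrite disjoint_subset; apply/subsetP => g /imsetP [f].
  case/setIdP => _ /andP [/codomP [q qv] nu] ->.
  have uin : u \in codom (tau f) by apply/codomP; exists q; rewrite ffunE -qv tpermR.
  have vout : v \notin codom (tau f).
    apply/negP => /codomP [p]; rewrite ffunE => /(congr1 (tperm u v)).
    by rewrite tpermK tpermR => E; case/negP: nu; rewrite E codom_f.
  by rewrite inE /= in_setD /embeddings_only in_set uin vout andbT; case: (_ \in _).
rewrite addnC -cardsUI.
have /eqP -> : K :&: tau @: embeddings_only h e v u == set0.
  by rewrite setI_eq0 disjoint_sym.
rewrite cards0 addn0; apply: subset_leq_card; rewrite subUset; apply/andP; split.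
  apply/subsetP => f; rewrite in_setD /embeddings_only in_set.
  move=> /andP [nf fE]; move: nf; rewrite fE /= negb_and negbK => uv.
  have [fI fh] := embeddingsP _ _ _ fE; apply/embeddingsP; split=> //.
  have key x y : h x y -> f x = u -> e v (f y) && (f y != u).
    move=> xy xu; case/orP: uv => [/negP[]|/codomP [q qv]].
      by rewrite -xu codom_f.
    have xq : ~~ h x q by apply/negP => /fh; rewrite xu -qv; apply/negP.
    apply/andP; split; first by rewrite qv; apply: fh; rewrite -(htw _ _ xq).
    apply/eqP => yu; have := fh _ _ xy; rewrite xu yu.
    by rewrite e0.
  move=> x y xy; rewrite /clone_rel /=.
  case: (eqVneq (f x) u) => [xu|xu].
    by have /andP [? /negPf ->] := key _ _ xy xu.
  case: (eqVneq (f y) u) => [yu|yu]; last exact: fh.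
  by rewrite eC; rewrite hC in xy; have /andP [] := key _ _ xy yu.
apply/subsetP => g /imsetP [f].
case/setIdP => fE /andP [vin uout] ->; have [fI fh] := embeddingsP _ _ _ fE.
have ne x : f x != u by apply: contraNneq uout => <-; apply: codom_f.
have cl x : (if tau f x == u then v else tau f x) = f x.
  rewrite ffunE; case: tpermP => [E|->|/eqP/negPf -> _] //; last by rewrite eqxx.
  by move: (ne x); rewrite E eqxx.
apply/embeddingsP; split.
  by move=> x y; rewrite !ffunE => /perm_inj /fI.
by move=> x y xy; rewrite /clone_rel /= !cl; apply: fh.
Qed.

Definition twins (T : finType) (e : rel T) (x : T) : {set T} :=
  [set y | [forall z, e x z == e y z]].

Lemma twinsP (T : finType) (e : rel T) (x y : T) :
  reflect (e x =1 e y) (y \in twins e x).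
Proof. by rewrite inE; apply: (iffP forallP) => E z; apply/eqP; rewrite E. Qed.

Lemma twins_sym (T : finType) (e : rel T) (x y : T) :
  (y \in twins e x) = (x \in twins e y).
Proof. by apply/twinsP/twinsP => E z; rewrite E. Qed.

Lemma twins_refl (T : finType) (e : rel T) (x : T) : x \in twins e x.
Proof. exact/twinsP. Qed.

(** Twin pairs not involving [u] persist. Each old twin of [v] gains [u], and only old twins of [u]
    can lose it; since [u] enters a class at least as large as the one it leaves, and its new class
    also counts [u] itself, the total strictly grows. *)
Lemma sum_twins_clone (T : finType) (e : rel T) (u v : T) :
    u \notin twins e v -> #|twins e u| <= #|twins e v| ->
  \sum_x #|twins e x| < \sum_x #|twins (clone_rel e u v) x|.
Proof.
move=> uv le; set e' := clone_rel e u v.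
have tw1 x y : x != u -> y != u -> y \in twins e x -> y \in twins e' x.
  move=> /negPf xu /negPf yu /twinsP E; apply/twinsP => z.
  by rewrite /e' /clone_rel /= xu yu E.
have tw2 y : y \in twins e v -> y \in twins e' u.
  case: (eqVneq y u) => [->|/negPf yu]; first by rewrite (negPf uv).
  by move/twinsP => E; apply/twinsP => z; rewrite /e' /clone_rel /= eqxx yu E.
rewrite (bigD1 u) //= [X in _ < X](bigD1 u) //=.
have Hu : #|twins e v| < #|twins e' u|.
  have sub : u |: twins e v \subset twins e' u.
    by apply/subsetP => y /setU1P [->|/tw2 //]; apply: twins_refl.
  by have := subset_leq_card sub; rewrite cardsU1 uv.
have Hx x : x != u ->
    #|twins e x| + (x \in twins e v) <= #|twins e' x| + (x \in twins e u).
  move=> xu; rewrite (cardsD1 u (twins e x)) (cardsD1 u (twins e' x)).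
  have : #|twins e x :\ u| <= #|twins e' x :\ u|.
    apply: subset_leq_card; apply/subsetP => y; rewrite !in_setD1.
    by case/andP => yu ?; rewrite yu tw1.
  rewrite (twins_sym e x u) (twins_sym e' x u).
  have : x \in twins e v -> x \in twins e' u := @tw2 x.
  by case: (x \in twins e v) => [->|] //; lia.
have S w : \sum_(x | x != u) (x \in twins e w : nat) = #|twins e w :\ u|.
  rewrite -sum1_card big_mkcond [RHS]big_mkcond /=.
  by apply: eq_bigr => x _; rewrite in_setD1; case: (x != u); case: (x \in _).
have : \sum_(x | x != u) (#|twins e x| + (x \in twins e v)) <=
       \sum_(x | x != u) (#|twins e' x| + (x \in twins e u)) by apply: leq_sum.
rewrite !big_split /= !S.
move: le Hu; rewrite (cardsD1 u (twins e v)) (negPf uv) (cardsD1 u (twins e u)).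
by rewrite twins_refl; lia.
Qed.

Lemma adj_graph_of_sym (T : finType) (e : rel T) : symmetric e ->
  irreflexive e -> adj (graph_of_rel e) =2 e.
Proof.
move=> eC e0 x y; rewrite adj_graph_of_rel (eC y x) orbb.
by case: eqVneq => // ->; rewrite e0.
Qed.

(* Take a maximiser, first for the number of embeddings, then for the number
   of twin pairs; cloning a vertex would improve it if two nonadjacent vertices
   were not twins. *)
Lemma zykov_symmetrization (V T : finType) (h : rel V) (G : sgraph T) k :
    symmetric h -> (forall x y, ~~ h x y -> h x =1 h y) ->
    ~~ contains (complete_graph k) G ->
  exists G' : sgraph T,
    [/\ ~~ contains (complete_graph k) G',
        #|embeddings h (adj G)| <= #|embeddings h (adj G')| &
        forall x y, ~~ adj G' x y -> adj G' x =1 adj G' y].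
Proof.
move=> hC htw GK.
pose tw (F : sgraph T) := \sum_x #|twins (adj F) x|.
(* The twin count is always below [B], so maximising [M] is maximising the pair (embeddings, twin
   count) lexicographically. *)
pose B := (#|T| * #|T|).+1.
pose M (F : sgraph T) := #|embeddings h (adj F)| * B + tw F.
have twB F : tw F < B.
  rewrite ltnS -sum_nat_const; apply: leq_sum => x _; exact: max_card.
have [F FK Fmax] := @arg_maxnP _ G (fun F => ~~ contains (complete_graph k) F) M GK.
exists F; split=> //.
  have := Fmax _ GK; rewrite /M; move: (twB F) (twB G).
  case: (leqP #|embeddings h (adj G)| #|embeddings h (adj F)|) => //; nia.
move=> x y nxy; apply/twinsP; apply/negPn/negP.
pose a x y := #|embeddings_only h (adj F) x y|.
pose le x y := (a x y < a y x) ||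
  (a x y == a y x) && (#|twins (adj F) x| <= #|twins (adj F) y|).
(* Choose the direction of cloning: [x] is to be replaced by a clone of [y], where [y] carries more
   private embeddings or, in a tie, at least as many twins. *)
wlog lexy : x y nxy / le x y.
  move=> W; have /orP [] : le x y || le y x; last 1 first.
  - by move=> H; rewrite twins_sym; apply: W => //; rewrite adj_sym.
  - rewrite /le; case: (ltngtP (a x y) (a y x)) => //= _; exact: leq_total.
  - exact: W.
rewrite twins_sym => ntw.
have [eC e0] := (clone_rel_sym x y (@adj_sym _ F), clone_rel_irr x y (@adj_irr _ F)).
pose F' := graph_of_rel (clone_rel (adj F) x y).
have F'E := adj_graph_of_sym eC e0.
have F'K : ~~ contains (complete_graph k) F'.
  (* A clique of the cloned graph becomes a clique of [F] once [x] is replaced by [y]. *)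
  apply: contra FK => /contains_completeP [f fK]; apply/contains_completeP.
  exists (fun i => if f i == x then y else f i) => i j ij.
  by have := fK i j ij; rewrite F'E.
have : M F' <= M F := Fmax _ F'K; rewrite leqNgt => /negP; apply; rewrite /M.
have := embeddings_clone hC htw (@adj_sym _ F) (@adj_irr _ F) nxy.
rewrite (eq_embeddings h F'E) -/(a x y) -/(a y x).
have -> : tw F' = \sum_z #|twins (clone_rel (adj F) x y) z|.
  apply: eq_bigr => z _; apply: eq_card => z'.
  by apply/twinsP/twinsP => E t; have := E t; rewrite !F'E.
move: (twB F); case/orP: lexy => [lt|/andP [/eqP -> lc]]; first nia.
by have := sum_twins_clone ntw lc; rewrite -/(tw F); nia.
Qed.

(** Nonadjacency coincides with having the same neighbourhood, so neighbourhoods serve as colours;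
    representatives of [r.+2] different neighbourhoods would form a forbidden clique. *)
Lemma twin_graph_coloring (T : finType) (G : sgraph T) (r : nat) :
    ~~ contains (complete_graph r.+2) G ->
    (forall x y, ~~ adj G x y -> adj G x =1 adj G y) ->
  exists c : T -> 'I_r.+1, forall x y, adj G x y = (c x != c y).
Proof.
move=> GK tw; pose N x := [set z | adj G x z].
have NE x y : adj G x y = (N x != N y).
  apply/idP/idP => [xy|]; last first.
    apply: contraNT => /tw E; apply/eqP/setP => z.
    by rewrite !inE E.
  by apply/eqP => /setP /(_ y); rewrite !inE xy adj_irr.
have le : #|N @: [set: T]| <= r.+1.
  rewrite leqNgt; apply: contra GK => lt; apply/contains_completeP.
  have pre (A : {set T}) : A \in N @: [set: T] -> exists x, N x == A.
    by case/imsetP => x _ ->; exists x.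
  exists (fun i => xchoose (pre _ (enum_valP (widen_ord lt i)))) => i j ij.
  rewrite NE.
  have /eqP -> := xchooseP (pre _ (enum_valP (widen_ord lt i))).
  have /eqP -> := xchooseP (pre _ (enum_valP (widen_ord lt j))).
  by apply: contraNneq ij => /enum_val_inj /(congr1 val) /= /val_inj ->.
pose s := enum (N @: [set: T]).
have Ns x : index (N x) s < r.+1.
  by apply: leq_trans le; rewrite cardE index_mem mem_enum imset_f.
exists (fun x => Ordinal (Ns x)) => x y; rewrite NE; congr (~~ _).
apply/eqP/eqP => [E|/(congr1 val) /= E]; first by apply: val_inj; rewrite /= E.
have inS z : N z \in s by rewrite mem_enum imset_f.
by rewrite -(nth_index set0 (inS x)) E nth_index.
Qed.

(** * Counting maps by resampling one value *)

Definition update (V T : finType) (f : {ffun V -> T}) (s : V) (t : T) :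
    {ffun V -> T} := [ffun x => if x == s then t else f x].

(* Resampling the value at [s]: the condition [f s \in Q f] has probability
   [#|Q f| / #|T|] when neither [X] nor [Q] depends on that value. *)
Lemma card_resample (V T : finType) (X : {set {ffun V -> T}}) (s : V)
    (Q : {ffun V -> T} -> {set T}) :
    (forall f t, f \in X -> update f s t \in X) ->
    (forall f t, Q (update f s t) = Q f) ->
  #|T| * #|[set f in X | f s \in Q f]| = \sum_(f in X) #|Q f|.
Proof.
move=> XU QU.
have updK (f : {ffun V -> T}) t : update (update f s t) s (f s) = f.
  by apply/ffunP => x; rewrite !ffunE; case: eqVneq => [->|].
have upds (f : {ffun V -> T}) t : update f s t s = t by rewrite ffunE eqxx.
pose A := [set f in X | f s \in Q f].
(* Exchanging the value at [s] with a spare value [t] is an involution; it matches the pairs of a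
   good map and any [t] with the pairs of a map [f] in [X] and a value [t] in [Q f]. *)
pose phi (z : {ffun V -> T} * T) := (update z.1 s z.2, z.1 s).
have phiK : involutive phi.
  by move=> [f t]; rewrite /phi /= updK upds.
rewrite -[X in X * _ = _]cardsT mulnC -cardsX.
rewrite -(card_imset _ (inv_inj phiK)).
under [RHS]eq_bigr do rewrite -sum1_card.
rewrite pair_big_dep /= sum1dep_card; apply: eq_card => -[f t].
rewrite [RHS]inE /=; apply/imsetP/andP => [[[g u]]|[fX tQ]].
  rewrite !inE andbT => /andP [/= gX gQ] [-> ->].
  by rewrite XU // QU.
exists (phi (f, t)); last by rewrite phiK.
by rewrite !inE /= XU // upds QU tQ.
Qed.

Lemma leq_card_resample (V T : finType) (X : {set {ffun V -> T}}) (s : V)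
    (Q : {ffun V -> T} -> {set T}) m :
    (forall f t, f \in X -> update f s t \in X) ->
    (forall f t, Q (update f s t) = Q f) -> (forall f, #|Q f| <= m) ->
  #|T| * #|[set f in X | f s \in Q f]| <= m * #|X|.
Proof.
move=> XU QU Qm; rewrite card_resample // mulnC -sum_nat_const.
exact: leq_sum.
Qed.

(** The nested comprehension has the shape counted by [card_resample], first at [q] and then at
    [p]. *)
Definition pinned (V T : finType) (p q : V) (W Z : {set T}) :
    {set {ffun V -> T}} :=
  [set f in [set f : {ffun V -> T} | f p \in W] | f q \in Z].

Lemma pinned_update (V T : finType) (p q s : V) (W Z : {set T}) f t :
    s != p -> s != q -> f \in pinned p q W Z ->
  update f s t \in pinned p q W Z.
Proof.
by move=> sp sq; rewrite !inE !ffunE (eq_sym p) (eq_sym q) (negPf sp) (negPf sq).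
Qed.

Lemma card_pinned (V T : finType) (p q : V) (W Z : {set T}) : p != q ->
  #|T| ^ 2 * #|pinned p q W Z| = #|W| * #|Z| * #|{: {ffun V -> T}}|.
Proof.
move=> pq; rewrite expnS expn1 -mulnA.
rewrite (@card_resample _ _ _ q (fun=> Z)) //; last first.
  by move=> f t; rewrite !inE ffunE (negPf pq).
rewrite sum_nat_const mulnA; set S := [set f | _].
have -> : S = [set f in [set: {ffun V -> T}] | f p \in W].
  by apply/setP => f; rewrite !inE.
rewrite (@card_resample _ _ _ p (fun=> W)) //; last by move=> f t; rewrite !inE.
by rewrite sum_nat_const cardsT -mulnA mulnC.
Qed.

Lemma card_union_bound (S I : finType) (X : {set S}) (P : pred I)
    (A : I -> {set S}) :
    (forall x, x \in X -> exists2 i, P i & x \in A i) ->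
  #|X| <= \sum_(i | P i) #|A i|.
Proof.
move=> XA; apply: (@leq_trans #|\bigcup_(i | P i) A i|).
  apply: subset_leq_card; apply/subsetP => x /XA [i Pi xA].
  by apply/bigcupP; exists i.
elim/big_rec2: _ => [|i a B _ le]; first by rewrite cards0.
by apply: leq_trans (leq_card_setU _ _) _; rewrite leq_add2l.
Qed.

Lemma card_disjoint_swap (T : finType) (A B : {set T}) :
    [disjoint A & B] -> #|A| = #|B| ->
  exists s : T -> T, [/\ involutive s, forall x, x \in A -> s x \in B,
    forall x, x \in B -> s x \in A & forall x, x \notin A -> x \notin B -> s x = x].
Proof.
move=> dAB cAB.
have hA x : x \in A -> (x \in B) = false by move=> xA; apply: (disjointFr dAB).
have hB x : x \in B -> (x \in A) = false by move=> xB; apply: (disjointFl dAB).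
pose tr (C D : {set T}) x := nth x (enum D) (index x (enum C)).
have trP (C D : {set T}) x : #|C| = #|D| -> x \in C -> tr C D x \in D.
  move=> cCD xC; rewrite -mem_enum; apply: mem_nth.
  by rewrite -cardE -cCD cardE index_mem mem_enum.
have trK (C D : {set T}) x : #|C| = #|D| -> x \in C -> tr D C (tr C D x) = x.
  move=> cCD xC; rewrite /tr index_uniq ?enum_uniq ?nth_index ?mem_enum //.
  by rewrite -cardE -cCD cardE index_mem mem_enum.
pose s x := if x \in A then tr A B x else if x \in B then tr B A x else x.
have sA x : x \in A -> s x \in B by move=> xA; rewrite /s xA trP.
have sB x : x \in B -> s x \in A by move=> xB; rewrite /s (hB _ xB) xB trP.
exists s; split=> // [x|x /negPf xA /negPf xB]; last by rewrite /s xA xB.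
case: (boolP (x \in A)) => xA.
  by have sx := sA _ xA; rewrite {1}/s (hB _ sx) sx /s xA trK.
case: (boolP (x \in B)) => xB.
  by have sx := sB _ xB; rewrite {1}/s sx /s (negPf xA) xB trK.
by rewrite /s !(negPf xA, negPf xB).
Qed.

(** * Moving one vertex to a smaller colour class *)

Definition color_class (T I : finType) (c : T -> I) (i : I) : {set T} :=
  [set x | c x == i].

Definition color_rel (T I : finType) (c : T -> I) : rel T :=
  [rel x y | c x != c y].

Definition recolor (T I : finType) (c : T -> I) (w : T) (j : I) : T -> I :=
  fun x => if x == w then j else c x.

Lemma color_embeddings_sub (V T I : finType) (h : rel V) (c c' : T -> I) f :
    f \in embeddings h (color_rel c) :\: embeddings h (color_rel c') ->
  exists x y, [/\ h x y, c (f x) != c (f y) & c' (f x) = c' (f y)].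
Proof.
rewrite in_setD => /andP [nf /embeddingsP [fI fh]].
have : ~~ [forall x, forall y, h x y ==> color_rel c' (f x) (f y)].
  by apply: contra nf => H; rewrite inE H andbT; apply/injectiveP.
rewrite negb_forall => /existsP [x]; rewrite negb_forall => /existsP [y].
rewrite negb_imply negbK => /andP [xy /eqP E].
by exists x, y; split=> //; apply: fh.
Qed.

Definition hitting (V T : finType) (Z : {set T}) : {set {ffun V -> T}} :=
  [set f : {ffun V -> T} | [exists q, f q \in Z]].

(* Recolouring [w] from class [i] to class [j] does not matter for embeddings
   avoiding the surplus [Z] of class [i]: a swap [s] of the two classes
   exchanges the embeddings lost and the embeddings gained. *)
Lemma recolor_avoiding (V T I : finType) (h : rel V) (c : T -> I) (w : T)
    (i j : I) (Z A0 : {set T}) :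
    i != j -> c w = i -> color_class c i = w |: (A0 :|: Z) ->
    w \notin A0 -> w \notin Z -> [disjoint A0 & Z] ->
    #|A0| = #|color_class c j| ->
  let E := embeddings h (color_rel c) in
  let E' := embeddings h (color_rel (recolor c w j)) in
  #|(E :\: E') :\: hitting V Z| <= #|(E' :\: E) :\: hitting V Z|.
Proof.
move=> ij cw ci wA wZ dAZ cA /=; set c' := recolor c w j.
have inA x : x \in A0 -> c x = i.
  move=> xA; have : x \in color_class c i by rewrite ci !inE xA orbT.
  by rewrite inE => /eqP.
have inZ x : x \in Z -> c x = i.
  move=> xZ; have : x \in color_class c i by rewrite ci !inE xZ !orbT.
  by rewrite inE => /eqP.
have inB x : (x \in color_class c j) = (c x == j) by rewrite inE.
have dAB : [disjoint A0 & color_class c j].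
  by rewrite disjoint_subset; apply/subsetP => x /inA E; rewrite inE /= inB E.
have [s [sK sA sB sO]] := card_disjoint_swap dAB cA.
have sw : s w = w by apply: sO => //; rewrite inB cw.
have sI := inv_inj sK.
have sZ x : x \in Z -> s x = x.
  move=> xZ; apply: sO; last by rewrite inB inZ.
  by rewrite (disjointFl dAZ xZ).
have swE x : (s x == w) = (x == w) by rewrite -{1}sw (inj_eq sI).
have cs x : x != w -> x \notin Z -> c (s x) = tperm i j (c x).
  move=> xw xZ; case: (boolP (x \in A0)) => xA.
    by have := sA _ xA; rewrite inB => /eqP ->; rewrite inA // tpermL.
  case: (boolP (c x == j)) => [/eqP E|cj].
    by rewrite E tpermR inA // sB // inB E.
  rewrite sO ?inB // tpermD 1?eq_sym //; apply/eqP => E.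
  have : x \in color_class c i by rewrite inE E.
  by rewrite ci !inE (negPf xw) (negPf xA) (negPf xZ).
(* Outside [Z], [s] carries [c] to [c'] and [c'] to [c] up to transposing [i] and [j]; the
   recoloured vertex [w] fits because [s] fixes it. Composing with [s] thus turns lost embeddings
   into gained ones. *)
have c1 x : x \notin Z -> c' (s x) = tperm i j (c x).
  rewrite /c' /recolor swE; case: eqVneq => [-> _|xw xZ]; last exact: cs.
  by rewrite cw tpermL.
have c2 x : x \notin Z -> c (s x) = tperm i j (c' x).
  rewrite /c' /recolor; case: eqVneq => [-> _|xw xZ]; last exact: cs.
  by rewrite sw cw tpermR.
pose S (f : {ffun V -> T}) := [ffun x => s (f x)].
have SI : injective S.
  by move=> f g E; apply/ffunP => x; apply: sI; have /ffunP/(_ x) := E; rewrite !ffunE.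
rewrite -(card_imset _ SI); apply: subset_leq_card; apply/subsetP => g.
case/imsetP => f /setDP [fE fZ] ->.
have [x [y [xy _ Exy]]] := color_embeddings_sub fE.
have /setDP [/embeddingsP [fI fh] _] := fE.
have nZ z : f z \notin Z.
  by apply: contra fZ => H; rewrite inE; apply/existsP; exists z.
apply/setDP; split; [apply/setDP; split|].
- apply/embeddingsP; split=> [a b|a b ab]; first by rewrite !ffunE => /sI /fI.
  by rewrite /color_rel /= !ffunE !c1 // (inj_eq perm_inj); apply: fh.
- apply/negP => /embeddingsP [_ /(_ _ _ xy)].
  by rewrite /color_rel /= !ffunE !c2 // Exy eqxx.
apply: contra fZ; rewrite !inE => /existsP [z]; rewrite ffunE => H.
by case/negP: (nZ z); rewrite -[f z]sK sZ.
Qed.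

(** After [recolor_avoiding], only maps meeting the surplus [Z] remain. Let [N0] count the maps with
    one fixed vertex sent to [w] and another into [Z]. The losses are at most
    [#|V| ^ 3 * m * N0 / #|T|], the gains at least [N0] minus [(#|V| ^ 2 + #|V|) * m * N0 / #|T|],
    and the bound on [m] makes the gains prevail. *)
Lemma embeddings_recolor (V T I : finType) (h : rel V) (c : T -> I) (w : T)
    (i j : I) m :
    symmetric h -> irreflexive h -> c w = i ->
    #|color_class c j| < #|color_class c i| ->
    (forall l, #|color_class c l| <= m) ->
    (#|V| ^ 3 + #|V| ^ 2 + #|V|) * m <= #|T| ->
  #|embeddings h (color_rel c)| <= #|embeddings h (color_rel (recolor c w j))|.
Proof.
move=> hC h0 cw lt cm mT; set c' := recolor c w j.
have ij : i != j by apply: contraTneq lt => ->; rewrite ltnn.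
have T0 : 0 < #|T| by apply/card_gt0P; exists w.
pose A := color_class c i :\ w.
have wi : w \in color_class c i by rewrite inE cw.
have ltA : #|color_class c j| <= #|A|.
  by move: lt; rewrite (cardsD1 w (color_class c i)) wi add1n ltnS.
pose A0 := [set x in take #|color_class c j| (enum A)].
have A0A : A0 \subset A.
  by apply/subsetP => x; rewrite inE => /mem_take; rewrite mem_enum.
have cA0 : #|A0| = #|color_class c j|.
  rewrite cardsE; have /card_uniqP -> := take_uniq #|color_class c j| (enum_uniq A).
  by rewrite size_takel // -cardE.
pose Z := A :\: A0.
have wA : w \notin A by rewrite !inE eqxx.
have wA0 : w \notin A0 by apply: contra wA; apply: (subsetP A0A).
have wZ : w \notin Z by rewrite in_setD negb_and wA orbT.
have AE : A0 :|: Z = A by rewrite -{1}(setIidPr A0A) setID.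
have ci : color_class c i = w |: (A0 :|: Z) by rewrite AE setD1K.
have dAZ : [disjoint A0 & Z].
  by rewrite -setI_eq0; apply/eqP/setP => x; rewrite !inE; case: (x \in take _ _).
have cZ x : x \in Z -> c x = i.
  by rewrite !inE => /and3P [_ _ /eqP].
pose UZ := hitting V Z.
set E := embeddings h (color_rel c); set E' := embeddings h (color_rel c').
rewrite -(cardsID E' E) -(cardsID E E') setIC leq_add2l.
rewrite -(cardsID UZ (E :\: E')) -(cardsID UZ (E' :\: E)).
apply: leq_add; last exact: (@recolor_avoiding _ _ _ h c w i j Z A0).
(* If some embedding is lost, it exhibits an edge [p0 q0] of [h], from which the gained embeddings
   are built. *)
case: (set_0Vmem ((E :\: E') :&: UZ)) => [->|[f1 /setIP [f1E _]]].
  by rewrite cards0.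
have [p0 [q0 [pq _ _]]] := color_embeddings_sub f1E.
have npq : p0 != q0 by apply: contraTneq pq => ->; rewrite h0.
set N0 := #|pinned p0 q0 [set w] Z|.
have pinE (p q : V) : p != q -> #|pinned p q [set w] Z| = N0.
  move=> ne.
  have := etrans (card_pinned [set w] Z ne) (esym (card_pinned [set w] Z npq)).
  by move/eqP; rewrite eqn_pmul2l ?expn_gt0 ?T0 // => /eqP.
(* A lost embedding sends one end [p] of an edge to [w], the other end [s] into class [j], and some
   [q] into [Z]. These targets are disjoint, so the three vertices are distinct, and the condition
   at [s] costs a factor [m / #|T|]. *)
have lost : #|T| * #|(E :\: E') :&: UZ| <= #|V| ^ 3 * (m * N0).
  pose P (z : V * V * V) := [&& z.1.1 != z.1.2, z.2 != z.1.1 & z.2 != z.1.2].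
  pose F (z : V * V * V) :=
    [set f in pinned z.1.1 z.1.2 [set w] Z | f z.2 \in color_class c j].
  have : #|(E :\: E') :&: UZ| <= \sum_(z | P z) #|F z|.
    apply: card_union_bound => f /setIP [fE]; rewrite inE => /existsP [q fq].
    have key p s : f p = w -> c (f s) = j -> exists2 z, P z & f \in F z.
      move=> fp fs; exists (p, q, s); rewrite /P /F /=.
        apply/and3P; split.
        - by apply: contraNneq wZ => E1; rewrite -fp E1.
        - by apply: contraNneq ij => E1; rewrite -fs E1 fp cw.
        - by apply: contraNneq ij => E1; rewrite -fs E1 cZ.
      by apply/setIdP; split; rewrite inE ?fs // inE fp inE eqxx.
    have [x [y [xy ne]]] := color_embeddings_sub fE.
    rewrite /c' /recolor; case: (eqVneq (f x) w) => [fx|nx];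
      case: (eqVneq (f y) w) => [fy|ny].
    - by rewrite fx fy eqxx in ne.
    - by move=> Ej; apply: (key x y).
    - by move=> Ej; apply: (key y x).
    - by move=> Ej; rewrite Ej eqxx in ne.
  rewrite -(leq_pmul2l T0) => /leq_trans; apply.
  rewrite big_distrr /=.
  apply: (@leq_trans (\sum_(z : V * V * V | P z) m * N0)).
    apply: leq_sum => -[[p q] s] /and3P [/= n1 n2 n3].
    rewrite -(pinE p q n1).
    apply: (@leq_card_resample _ _ _ s (fun=> color_class c j)) => // f t.
    exact: pinned_update.
  rewrite sum_nat_const leq_mul2r; apply/orP; right.
  by apply: leq_trans (max_card _) _; rewrite !card_prod !expnS expn0 muln1 mulnA.
(* Take maps with [p0] sent to [w] and [q0] into [Z]: the edge [p0 q0] is monochromatic for [c].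
   Such a map is gained unless some third vertex falls into class [j] (index [None]) or into the
   [c]-class of the image of another vertex [s] (index [Some s]). *)
have gained : #|T| * N0 <=
    #|T| * #|(E' :\: E) :&: UZ| + (#|V| ^ 2 + #|V|) * (m * N0).
  pose X := pinned p0 q0 [set w] Z.
  pose P (z : V * option V) := [&& z.1 != p0, z.1 != q0 & z.2 != Some z.1].
  pose Q (o : option V) (f : {ffun V -> T}) :=
    color_class c (if o is Some s then c (f s) else j).
  pose F (z : V * option V) := [set f in X | f z.1 \in Q z.2 f].
  have U : #|X :\: ((E' :\: E) :&: UZ)| <= \sum_(z | P z) #|F z|.
    apply: card_union_bound => f /setDP [fX nf].
    have [fpW fq] := setIdP fX; have fp : f p0 = w by apply/set1P; rewrite inE in fpW.
    apply/exists_inP; apply: contraNT nf; rewrite negb_exists_in => /forall_inP H.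
    have Hs s o : P (s, o) -> c (f s) != (if o is Some s' then c (f s') else j).
      by move=> Pso; apply: contra (H _ Pso) => fQ; apply/setIdP; split; rewrite // inE.
    have cq : c (f q0) = i by apply: cZ.
    have key x y : x != y -> y != p0 -> y != q0 -> c' (f x) != c' (f y).
      move=> xy yp yq.
      have yj : c (f y) != j by apply: (Hs y None); rewrite /P /= yp yq.
      have yo x' : x' != y -> c (f y) != c (f x').
        move=> ne; apply: (Hs y (Some x')); rewrite /P /= yp yq /=.
        by apply: contraNneq ne => -[->].
      have yi : f y != w.
        by apply/eqP => yw; have := yo p0; rewrite yw fp eqxx eq_sym => /(_ yp).
      rewrite /c' /recolor (negPf yi); case: (eqVneq (f x) w) => _; first by rewrite eq_sym.
      by rewrite eq_sym yo.
    have dist x y : x != y -> c' (f x) != c' (f y).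
      move=> xy; case: (boolP ((y != p0) && (y != q0))) => [/andP[]|ny].
        exact: key.
      case: (boolP ((x != p0) && (x != q0))) => [/andP[xp xq]|nx].
        by rewrite eq_sym; apply: key => //; rewrite eq_sym.
      have fqw : (f q0 == w) = false by apply: contraNF wZ => /eqP <-.
      move: nx ny xy; rewrite !negb_and !negbK.
      by case/orP => /eqP -> /orP [] /eqP ->; rewrite ?eqxx // => _;
        rewrite /c' /recolor fp eqxx fqw cq // eq_sym.
    apply/setIP; split; last by rewrite inE; apply/existsP; exists q0.
    apply/setDP; split.
      apply/embeddingsP; split=> x y.
        by apply: contra_eq => xy; apply: contraNneq (dist _ _ xy) => ->.
      by move=> xy; apply: dist; apply: contraTneq xy => ->; rewrite h0.
    by apply/negP => /embeddingsP [_ /(_ _ _ pq)]; rewrite /color_rel /= fp cw cq eqxx.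
  have UT : #|T| * #|X :\: ((E' :\: E) :&: UZ)| <= (#|V| ^ 2 + #|V|) * (m * N0).
    move: U; rewrite -(leq_pmul2l T0) => /leq_trans; apply.
    rewrite big_distrr /=.
    apply: (@leq_trans (\sum_(z : V * option V | P z) m * N0)).
      apply: leq_sum => -[s o] /and3P [/= n1 n2 n3].
      apply: (@leq_card_resample _ _ _ s (Q o)) => f => [t|t|].
      - exact: pinned_update.
      - case: o n3 => [s'|] n3 //; rewrite /Q ffunE.
        by rewrite (_ : (s' == s) = false) //; apply: contraNF n3 => /eqP ->.
      - exact: cm.
    rewrite sum_nat_const leq_mul2r; apply/orP; right.
    by apply: leq_trans (max_card _) _; rewrite card_prod card_option mulnS expnS expn1 addnC.
  rewrite {1}/N0 -(cardsID ((E' :\: E) :&: UZ) (pinned _ _ _ _)).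
  rewrite mulnDr; apply: leq_add; last exact: UT.
  rewrite leq_mul2l; apply/orP; right.
  by apply: subset_leq_card; apply: subsetIr.
rewrite -(leq_pmul2l T0); apply: leq_trans lost _.
rewrite -(leq_add2r ((#|V| ^ 2 + #|V|) * (m * N0))); apply: leq_trans gained.
rewrite -mulnDl mulnA -(mulnC N0) -(mulnC N0) leq_mul2l; apply/orP; right.
by rewrite addnA.
Qed.

(** * Optimality of balanced colourings *)

(** Union bound: a map giving distinct vertices distinct colours is an embedding, and each ordered
    pair of vertices shares a colour with probability at most [m / #|T|]. *)
Lemma card_color_embeddings_lower (V T I : finType) (h : rel V) (t : T -> I) m :
    irreflexive h -> (forall l, #|color_class t l| <= m) ->
  #|T| * #|{: {ffun V -> T}}| <=
  #|T| * #|embeddings h (color_rel t)| + #|V| ^ 2 * (m * #|{: {ffun V -> T}}|).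
Proof.
move=> h0 tm.
pose F (z : V * V) :=
  [set f : {ffun V -> T} in [set: {ffun V -> T}] | f z.1 \in color_class t (t (f z.2))].
have U : #|~: embeddings h (color_rel t)| <= \sum_(z : V * V | z.1 != z.2) #|F z|.
  apply: card_union_bound => f; rewrite inE => nf.
  apply/exists_inP; apply: contraNT nf; rewrite negb_exists_in => /forall_inP H.
  have dist x y : x != y -> t (f x) != t (f y).
    by move=> xy; have := H (x, y) xy; rewrite !inE.
  apply/embeddingsP; split=> x y.
    by apply: contra_eq => xy; apply: contraNneq (dist _ _ xy) => ->.
  by move=> xy; apply: dist; apply: contraTneq xy => ->; rewrite h0.
rewrite -[in leqLHS](cardsC (embeddings h (color_rel t))) mulnDr leq_add2l.
apply: leq_trans (leq_mul (leqnn _) U) _; rewrite big_distrr /=.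
apply: (@leq_trans (\sum_(z : V * V | z.1 != z.2) m * #|{: {ffun V -> T}}|)).
  apply: leq_sum => -[x y] /= xy; rewrite -[#|{: {ffun V -> T}}|]cardsT.
  apply: (leq_card_resample (Q := fun f => color_class t (t (f y)))) => [f u|f u|f].
  - by rewrite !inE.
  - by rewrite ffunE eq_sym (negPf xy).
  - exact: tm.
rewrite sum_nat_const leq_mul2r; apply/orP; right.
by apply: leq_trans (max_card _) _; rewrite card_prod expnS expn1.
Qed.

(** Maps sending both ends of the edge [p q] into class [i] are never embeddings. *)
Lemma card_color_embeddings_upper (V T I : finType) (h : rel V) (c : T -> I)
    (p q : V) (i : I) : p != q -> h p q ->
  #|T| ^ 2 * #|embeddings h (color_rel c)| +
  #|color_class c i| ^ 2 * #|{: {ffun V -> T}}| <= #|T| ^ 2 * #|{: {ffun V -> T}}|.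
Proof.
move=> npq pq; rewrite [X in _ + X * _]expnS expn1 -(card_pinned _ _ npq) -mulnDr.
rewrite leq_mul2l; apply/orP; right.
set E := embeddings _ _; rewrite -(cardsC E) leq_add2l.
apply: subset_leq_card; apply/subsetP => f /setIdP [].
move=> fp fq; rewrite in_setC; rewrite !inE in fp fq.
by apply/negP => /embeddingsP [_ /(_ _ _ pq)]; rewrite /color_rel /= (eqP fp) (eqP fq) eqxx.
Qed.

Lemma eq_of_leq_sum (I : finType) (a b : I -> nat) :
  (forall i, a i <= b i) -> \sum_i a i = \sum_i b i -> a =1 b.
Proof.
move=> ab E i; apply/eqP; rewrite eqn_leq ab leqNgt; apply/negP => lt.
move: E; rewrite (bigD1 i) // [RHS](bigD1 i) //=.
have : \sum_(l | l != i) a l <= \sum_(l | l != i) b l by apply: leq_sum.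
lia.
Qed.

Lemma sum_color_class (T I : finType) (c : T -> I) :
  \sum_i #|color_class c i| = #|T|.
Proof.
rewrite -sum1_card (partition_big c xpredT) //=; apply: eq_bigr => i _.
by rewrite -sum1_card; apply: eq_bigl => x; rewrite inE.
Qed.

(** Matching classes of equal size position by position gives an injection [s] of [T] with
    [t (s x) = c x], and composing with it preserves embeddings. *)
Lemma color_embeddings_iso (V T I : finType) (h : rel V) (c t : T -> I) :
    (forall i, #|color_class c i| = #|color_class t i|) ->
  #|embeddings h (color_rel c)| <= #|embeddings h (color_rel t)|.
Proof.
move=> ct.
pose s x := nth x (enum (color_class t (c x))) (index x (enum (color_class c (c x)))).
have ix x : index x (enum (color_class c (c x))) < size (enum (color_class t (c x))).
  by rewrite -cardE -ct cardE index_mem mem_enum inE.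
have ts x : t (s x) = c x.
  have : s x \in enum (color_class t (c x)) by apply: mem_nth.
  by rewrite mem_enum inE => /eqP.
have sI : injective s.
  move=> x y E; have cxy : c x = c y by rewrite -!ts E.
  move: E (ix x) (ix y); rewrite /s cxy => E lx ly.
  rewrite (set_nth_default x y ly) in E.
  have /eqP := E; rewrite nth_uniq ?enum_uniq // => /eqP Ei.
  have xs : x \in enum (color_class c (c y)) by rewrite mem_enum inE cxy.
  by rewrite -(nth_index x xs) Ei nth_index // mem_enum inE.
pose S (f : {ffun V -> T}) := [ffun x => s (f x)].
have SI : injective S.
  by move=> f g E; apply/ffunP => x; apply: sI; have /ffunP/(_ x) := E; rewrite !ffunE.
rewrite -(card_imset _ SI); apply: subset_leq_card; apply/subsetP => g.
case/imsetP => f /embeddingsP [fI fh] ->; apply/embeddingsP; split=> x y.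
  by rewrite !ffunE => /sI /fI.
by rewrite /color_rel /= !ffunE !ts; apply: fh.
Qed.

(* [embeddings_recolor] applies once every class has at most
   [#|T| / move_const #|V|] vertices. *)
Definition move_const (v : nat) : nat := v ^ 3 + v ^ 2 + v.

(** Induction on the total excess of the classes of [c] over those of [t]. Unless [c] already does
    worse than [t], its classes are small enough for [embeddings_recolor], and a vertex can move
    from an oversized class to an undersized one. *)
Lemma balanced_coloring_max (V T I : finType) (h : rel V) (t : T -> I) m :
    symmetric h -> irreflexive h ->
    (forall l l', #|color_class t l| <= #|color_class t l'|.+1) ->
    (forall l, #|color_class t l| <= m) ->
    (move_const #|V| * #|V|) ^ 2 * m <= #|T| ->
  forall c : T -> I,
    #|embeddings h (color_rel c)| <= #|embeddings h (color_rel t)|.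
Proof.
move=> hC h0 tb tm mT.
case: (boolP [exists p, exists q, h p q]) => [/existsP [p /existsP [q pq]]|nh]; last first.
  (* Without edges in [h], the embeddings are all the injections, whatever the colouring. *)
  move=> c; apply: subset_leq_card; apply/subsetP => f /embeddingsP [fI _].
  apply/embeddingsP; split=> // x y xy; case/negP: nh.
  by apply/existsP; exists x; apply/existsP; exists y.
have npq : p != q by apply: contraTneq pq => ->; rewrite h0.
have V0 : 0 < #|V| by apply/card_gt0P; exists p.
have C0 : 0 < move_const #|V| by rewrite /move_const; lia.
move=> c; have [N] := ubnP (\sum_l (#|color_class c l| - #|color_class t l|)).
elim: N c => // N IH c; rewrite ltnS => leN.
case: (ltnP #|embeddings h (color_rel c)| #|embeddings h (color_rel t)|) => [/ltnW //|tc].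
have [T0|T0] := posnP #|T|.
  apply: color_embeddings_iso => i; apply/eqP; rewrite eqn_leq.
  by have := max_card (color_class c i); have := max_card (color_class t i); lia.
case: (boolP [forall i, #|color_class c i| <= #|color_class t i|]) => [/forallP le|].
  apply: color_embeddings_iso; apply: eq_of_leq_sum => //.
  by rewrite !sum_color_class.
rewrite negb_forall => /existsP [i]; rewrite -ltnNge => lti.
have [j ltj] : exists j, #|color_class c j| < #|color_class t j|.
  apply/existsP; apply: contraLR lti; rewrite negb_exists -leqNgt => /forallP H.
  rewrite (@eq_of_leq_sum _ (fun l => #|color_class t l|) (fun l => #|color_class c l|)) //.
    by move=> l; rewrite leqNgt.
  by rewrite !sum_color_class.
have ij : i != j by apply: contraTneq ltj => <-; rewrite -leqNgt ltnW.
have [w wi] : exists w, w \in color_class c i.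
  by apply/card_gt0P; apply: leq_ltn_trans lti.
have cw : c w = i by move: wi; rewrite inE => /eqP.
(* As [c] does at least as well as [t], the proportion [(z / n) ^ 2] lost to a class of size [z] is
   at most the loss [#|V| ^ 2 * m / n] of [t]. Hence [z ^ 2 <= n * #|V| ^ 2 * m], and the hypothesis
   on [m] yields [C * z <= n]. *)
have small l : #|color_class c l| <= #|T| %/ move_const #|V|.
  rewrite leq_divRL // mulnC.
  have := card_color_embeddings_upper c l npq pq.
  have := card_color_embeddings_lower h0 tm.
  set X := #|{: {ffun V -> T}}|; set z := #|color_class c l|.
  set a := #|embeddings h (color_rel t)| in tc *.
  set b := #|embeddings h (color_rel c)| in tc *.
  set n := #|T| in mT T0 *; set C := move_const #|V| in mT *.
  have X0 : 0 < X by apply/card_gt0P; exists [ffun=> w].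
  move=> lo up.
  have zX : z ^ 2 * X <= n * #|V| ^ 2 * m * X.
    have : n * (n * X) <= n * (n * a + #|V| ^ 2 * (m * X)) by rewrite leq_mul2l lo orbT.
    have : n ^ 2 * a <= n ^ 2 * b by rewrite leq_mul2l tc orbT.
    by move: up; rewrite (expnS n 1) expn1; lia.
  rewrite leq_pmul2r // in zX.
  rewrite -(leq_exp2r _ _ (isT : 0 < 2)) expnMn.
  apply: (@leq_trans (C ^ 2 * (n * #|V| ^ 2 * m))); first by rewrite leq_mul2l zX orbT.
  move: mT; rewrite expnMn => mT.
  have : n * (C ^ 2 * #|V| ^ 2 * m) <= n * n by rewrite leq_mul2l mT orbT.
  by rewrite [n ^ 2]expnS expn1; lia.
(* Class [j] is below its size in [t], class [i] above, and the sizes in [t] differ by at most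
   one. *)
have lt : #|color_class c j| < #|color_class c i|.
  by have := tb j i; lia.
have step : #|embeddings h (color_rel c)| <= #|embeddings h (color_rel (recolor c w j))|.
  apply: (embeddings_recolor hC h0 cw lt small).
  by rewrite mulnC leq_trunc_div.
apply: leq_trans step _; apply: IH; apply: leq_trans leN.
have cc l : l != i -> l != j -> color_class (recolor c w j) l = color_class c l.
  move=> li lj; apply/setP => x; rewrite !inE /recolor.
  by case: (eqVneq x w) => [->|//]; rewrite cw eq_sym (negPf lj) eq_sym (negPf li).
have cci : color_class (recolor c w j) i = color_class c i :\ w.
  by apply/setP => x; rewrite !inE /recolor; case: (eqVneq x w) => //= _; rewrite eq_sym (negPf ij).
have ccj : color_class (recolor c w j) j = w |: color_class c j.
  by apply/setP => x; rewrite !inE /recolor; case: (eqVneq x w) => //= _; rewrite eqxx.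
(* The positive excess of class [i] drops by one; class [j] had a deficit, so its truncated
   difference stays zero. *)
rewrite (bigD1 i) //= [X in _ < X](bigD1 i) //= cci -addSn leq_add //.
  by move: lti; rewrite (cardsD1 w (color_class c i)) wi; lia.
apply: leq_sum => l li; case: (eqVneq l j) => [->|lj]; last by rewrite cc.
rewrite ccj cardsU1 inE cw (negPf ij) /=; lia.
Qed.

(** * The Turan colouring and the conclusion *)

Definition turan_color (r n : nat) (x : 'I_n) : 'I_r.+1 := inord (x %% r.+1).

Lemma val_turan_color (r n : nat) (x : 'I_n) :
  turan_color r x = x %% r.+1 :> nat.
Proof. by rewrite inordK // ltn_pmod. Qed.

Lemma adj_turan_graph (r n : nat) :
  adj (turan_graph r.+1 n) =2 color_rel (@turan_color r n).
Proof.
move=> x y; rewrite adj_graph_of_rel /= /color_rel /= -[turan_color _ _ == _](inj_eq val_inj) /=.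
rewrite !val_turan_color (eq_sym (y %% _)) orbb.
by case: (eqVneq x y) => // ->; rewrite eqxx.
Qed.

Lemma card_turan_color (r n : nat) (l : 'I_r.+1) :
  #|color_class (@turan_color r n) l| = n %/ r.+1 + (l < n %% r.+1).
Proof.
rewrite -card_turan_class //; apply: eq_card => x.
by rewrite !inE -(inj_eq val_inj) /= val_turan_color.
Qed.

Lemma turan_graph_Kfree (r n : nat) :
  ~~ contains (complete_graph r.+2) (turan_graph r.+1 n).
Proof.
apply/contains_completeP => -[f fK].
have /leq_card : injective (fun i => turan_color r (f i)).
  move=> i j E; apply/eqP/negP => /negP /fK.
  by rewrite adj_turan_graph /color_rel /= E eqxx.
by rewrite !card_ord ltnn.
Qed.

Lemma small_graph_Kfree (V : finType) (H : sgraph V) (k : nat) :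
  #|V| < k -> ~~ contains (complete_graph k) H.
Proof.
move=> Vk; apply/contains_completeP => -[f fK].
have /leq_card : injective f.
  by move=> i j E; apply/eqP/negP => /negP /fK; rewrite E adj_irr.
by rewrite card_ord leqNgt Vk.
Qed.

Theorem theorem10 (V : finType) (H : sgraph V) :
  complete_multipartite H ->
  exists k0 : nat, forall k : nat, k0 <= k -> turan_good k H.
Proof.
case=> P _ HP.
have tw x y : ~~ adj H x y -> adj H x =1 adj H y.
  by rewrite HP negbK => /eqP E z; rewrite !HP E.
pose D := (move_const #|V| * #|V|) ^ 2.
(* With [k = r.+2], the term [#|V|] keeps [H] free of the forbidden clique. The term [2 * D] serves
   the size condition: for [n >= r.+1] the quotient [q = n %/ r.+1] is positive, so
   [D * (q + 1) <= 2 * D * q <= n]. *)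
exists (2 * D + #|V| + 2) => -[|[|r]] le; [lia|lia|].
split; first by apply: small_graph_Kfree; lia.
exists r.+1 => n rn; apply/eqP; rewrite eqn_leq; apply/andP; split; last first.
  by apply: (leq_bigmax_cond (turan_graph r.+1 n)); apply: turan_graph_Kfree.
apply/bigmax_leqP => G GK; rewrite leq_Ncopies.
have [G' [G'K GG' G'tw]] := zykov_symmetrization (@adj_sym _ H) tw GK.
apply: leq_trans GG' _; have [c cE] := twin_graph_coloring G'K G'tw.
rewrite (eq_embeddings _ (e' := color_rel c) cE) (eq_embeddings _ (@adj_turan_graph r n)).
apply: (@balanced_coloring_max _ _ _ _ _ (n %/ r.+1 + 1)).
- exact: adj_sym.
- exact: adj_irr.
- by move=> l l'; rewrite !card_turan_color; lia.
- by move=> l; rewrite card_turan_color; lia.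
rewrite -/D card_ord; have := leq_trunc_div n r.+1; set q := n %/ r.+1.
by move: le rn; set d := #|V|; nia.
Qed.
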